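(* Let $q\geq 3$ and $n\ge1$ be integers and let $1\leq d'\leq d\leq n$ with $d'+d\leq n+1$. Let $f:\mathbb{Z}_q^n\to\{0,1\}$ (or $f:\mathbb{Z}_q^n\to\{-1,1\}$) be a Boolean function such that $\widehat{f}(u)=0$ for every $u\in\mathbb{Z}_q^n$ with $|u|\notin\{0\}\cup\{d',d'+1,\ldots,d\}$ (i.e. $f\in U_0(n,q)\oplus U_{d'}(n,q)\oplus\cdots\oplus U_d(n,q)$). Then $f$ has at most $\frac{d}{2}\cdot\frac{q^{d+d'}}{2^{d'}(q-1)^{d'}}$ relevant variables.
   Context: For $u\in\mathbb{Z}_q^n$, $|u|$ is the Hamming weight (number of nonzero coordinates). With $\omega=e^{2\pi i/q}$ and $\chi_u(x)=\omega^{u_1x_1+\cdots+u_nx_n}$, every $f:\mathbb{Z}_q^n\to\mathbb{C}$ is uniquely written as $f=\sum_u\widehat{f}(u)\chi_u$. $U_k(n,q)$ denotes the eigenspace of the adjacency operator of the Hamming graph $H(n,q)$ (vertex set $\mathbb{Z}_q^n$, adjacency = differing in exactly one coordinate) for the eigenvalue $n(q-1)-qk$; it is spanned by the $\chi_u$ with $|u|=k$. A variable $x_i$ of $f$ is relevant if there exist $a_j\in\mathbb{Z}_q$ ($j\neq i$) and $b_1,b_2\in\mathbb{Z}_q$ such that $f(a_1,\ldots,a_{i-1},b_1,a_{i+1},\ldots,a_n)\neq f(a_1,\ldots,a_{i-1},b_2,a_{i+1},\ldots,a_n)$. *)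

(* Defs.v *)
From HB Require Import structures.
From mathcomp Require Import all_boot all_order all_algebra.
From mathcomp Require Import complex.
From mathcomp Require Import reals trigo.

Set Implicit Arguments.
Unset Strict Implicit.
Unset Printing Implicit Defensive.

Import Order.TTheory GRing.Theory Num.Theory.
Local Open Scope ring_scope.

(* Z_q^n is represented by 'rV['Z_q]_n; this is only correct for q >= 2. *)

Definition hamming_weight (q n : nat) (u : 'rV['Z_q]_n) : nat :=
  #|[set i : 'I_n | u 0 i != 0]|.

Definition dot (q n : nat) (u x : 'rV['Z_q]_n) : 'Z_q :=
  \sum_(i < n) u 0 i * x 0 i.

(* e^(2 pi i / q) *)
Definition omega (R : realType) (q : nat) : R[i] :=
  Complex (cos (2 * pi / q%:R)) (sin (2 * pi / q%:R)).

(* The exponent is the representative of the dot product in [0, q). *)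
Definition character (R : realType) (q n : nat) (u x : 'rV['Z_q]_n) : R[i] :=
  omega R q ^+ nat_of_ord (dot u x).

(* Closed form of the coefficients of f in the basis of characters: they are
   characterized by fourier_expansion and fourier_unique below. *)
Definition fourier (R : realType) (q n : nat) (f : 'rV['Z_q]_n -> R[i])
    (u : 'rV['Z_q]_n) : R[i] :=
  (q ^ n)%:R^-1 * \sum_x f x * (character R u x)^*.

Definition set_coord (q n : nat) (a : 'rV['Z_q]_n) (i : 'I_n) (b : 'Z_q) :
    'rV['Z_q]_n :=
  \row_j (if j == i then b else a 0 j).

Definition relevant (R : realType) (q n : nat) (f : 'rV['Z_q]_n -> R[i])
    (i : 'I_n) : bool :=
  [exists a : 'rV['Z_q]_n, exists b1 : 'Z_q, exists b2 : 'Z_q,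
     f (set_coord a i b1) != f (set_coord a i b2)].

Lemma omegaX (R : realType) (q k : nat) : omega R q ^+ k =
  Complex (cos (k%:R * (2 * pi / q%:R))) (sin (k%:R * (2 * pi / q%:R))).
Proof.
elim: k => [|k IHk]; first by rewrite expr0 mul0r cos0 sin0.
rewrite exprSr IHk /omega; set t := 2 * pi / _.
have -> : k.+1%:R * t = k%:R * t + t by rewrite -natr1 mulrDl mul1r.
rewrite cosD sinD.
rewrite [LHS]/GRing.mul /=; congr Complex.
by rewrite addrC (mulrC (sin _) (cos _)).
Qed.

Lemma omega_expq (R : realType) (q : nat) : (1 < q)%N -> omega R q ^+ q = 1.
Proof.
move=> q1; have q0 : (q%:R : R) != 0 by rewrite pnatr_eq0; case: q q1.
by rewrite omegaX mulrC divfK // mulr_natl cos2pi sin2pi.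
Qed.

Lemma omegaX_neq1 (R : realType) (q k : nat) :
  (0 < k < q)%N -> omega R q ^+ k != 1.
Proof.
move=> /andP[k0 kq]; have q0 : (0 < q%:R :> R) by rewrite ltr0n (ltn_trans k0).
rewrite omegaX; set t : R := k%:R * (pi / q%:R).
have -> : k%:R * (2 * pi / q%:R) = t + t :> R.
  by rewrite -mulrA mulrCA -/t mulr_natl mulr2n.
have st : 0 < sin t.
  apply: sin_gt0_pi; rewrite mulr_gt0 ?divr_gt0 ?pi_gt0 //= ?ltr0n //.
  by rewrite /t mulrCA gtr_pMr ?pi_gt0 // ltr_pdivrMr // mul1r ltr_nat.
apply/eqP => /(congr1 (@complex.Re R)) /=; rewrite cosD -!expr2 cos2sin2 => /eqP.
rewrite -subr_eq0 addrAC (addrAC 1) subrr add0r -opprD oppr_eq0.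
by rewrite -mulr2n mulrn_eq0 /= sqrf_eq0 gt_eqF.
Qed.

Lemma omega_conj (R : realType) (q : nat) : omega R q * (omega R q)^* = 1.
Proof.
rewrite /omega [_^*]/= [LHS]/GRing.mul /= mulrN opprK -!expr2 cos2Dsin2.
by rewrite mulrN mulrC addNr.
Qed.

Lemma omegaD (R : realType) (q : nat) (a b : 'Z_q) : (1 < q)%N ->
  omega R q ^+ nat_of_ord (a + b) =
  omega R q ^+ nat_of_ord a * omega R q ^+ nat_of_ord b.
Proof.
move=> q1; rewrite -exprD -[in RHS](expr_mod _ (omega_expq R q1)).
by congr (_ ^+ (_ %% _)); apply: Zp_cast.
Qed.

Lemma dotC (q n : nat) (u x : 'rV['Z_q]_n) : dot u x = dot x u.
Proof. by apply: eq_bigr => i _; rewrite mulrC. Qed.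

Lemma dotDl (q n : nat) (u v x : 'rV['Z_q]_n) :
  dot (u + v) x = dot u x + dot v x.
Proof.
by rewrite /dot -big_split; apply: eq_bigr => i _; rewrite mxE mulrDl.
Qed.

Lemma characterC (R : realType) (q n : nat) (u x : 'rV['Z_q]_n) :
  character R u x = character R x u.
Proof. by rewrite /character dotC. Qed.

Lemma characterDl (R : realType) (q n : nat) (u v x : 'rV['Z_q]_n) :
  (1 < q)%N ->
  character R (u + v) x = character R u x * character R v x.
Proof. by move=> q1; rewrite /character dotDl omegaD. Qed.

Lemma character_conj (R : realType) (q n : nat) (u v x : 'rV['Z_q]_n) :
  (1 < q)%N ->
  character R u x * (character R v x)^* = character R (u - v) x.
Proof.
move=> q1; have -> : character R u x = character R (u - v) x * character R v x.
  by rewrite -characterDl // subrK.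
rewrite -mulrA.
by rewrite /character rmorphXn -exprMn omega_conj expr1n mulr1.
Qed.

Lemma sum_character (R : realType) (q n : nat) (u : 'rV['Z_q]_n) :
  (1 < q)%N -> \sum_x character R u x = (q ^ n)%:R * (u == 0)%:R.
Proof.
move=> q1; have [->|u0] := eqVneq u 0.
  rewrite (eq_bigr (fun=> 1)) => [|x _]; last first.
    by rewrite /character /dot big1 // => i _; rewrite mxE mul0r.
  by rewrite sumr_const card_mx card_ord mul1n Zp_cast // mulr1.
have [i ui0] : exists i, u 0 i != 0.
  apply/existsP; apply: contraNT u0 => /existsPn h.
  by apply/eqP/rowP => i; rewrite mxE; apply/eqP; move: (h i); rewrite negbK.
rewrite mulr0; set s := \sum_x _.
have : s = character R u (delta_mx 0 i) * s.
  rewrite mulr_sumr /s (reindex_inj (addrI (delta_mx 0 i))) /=.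
  by apply: eq_bigr => x _; rewrite ![character _ u _]characterC characterDl.
have e : dot u (delta_mx 0 i) = u 0 i.
  rewrite /dot (bigD1 i) //= mxE !eqxx mulr1 big1 ?addr0 // => j ji.
  by rewrite mxE eqxx (negPf ji) mulr0.
move/eqP; rewrite -subr_eq0 -{1}[s]mul1r -mulrBl mulf_eq0 subr_eq0 eq_sym.
rewrite /character e (negPf (omegaX_neq1 _ _)) /= => [/eqP //|].
rewrite lt0n; apply/andP; split; first exact: ui0.
by have := ltn_ord (u 0 i); rewrite [X in (_ < X)%N]Zp_cast.
Qed.

Lemma qn_neq0 (R : realType) (q n : nat) : (1 < q)%N -> (q ^ n)%:R != 0 :> R[i].
Proof. by move=> q1; rewrite pnatr_eq0 -lt0n expn_gt0 (ltn_trans _ q1). Qed.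

Lemma fourier_expansion (R : realType) (q n : nat) (f : 'rV['Z_q]_n -> R[i])
    (x : 'rV['Z_q]_n) :
  (1 < q)%N -> f x = \sum_u fourier f u * character R u x.
Proof.
move=> q1; under eq_bigr do rewrite /fourier -mulrA mulr_suml.
rewrite -mulr_sumr exchange_big /=.
have E y : \sum_u f y * (character R u y)^* * character R u x =
           f y * ((q ^ n)%:R * (x - y == 0)%:R).
  rewrite -sum_character // mulr_sumr; apply: eq_bigr => u _.
  by rewrite -mulrA (mulrC _^*) !(characterC R u) character_conj.
rewrite (bigD1 x) //= [X in _ + X]big1 => [|y yx].
  by rewrite E subrr eqxx addr0 mulr1 mulrCA mulVf ?mulr1 ?qn_neq0.
by rewrite E subr_eq0 eq_sym (negPf yx) !mulr0.
Qed.

Lemma fourier_unique (R : realType) (q n : nat) (f c : 'rV['Z_q]_n -> R[i]) :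
  (1 < q)%N -> (forall x, f x = \sum_u c u * character R u x) ->
  forall u, c u = fourier f u.
Proof.
move=> q1 fE u; rewrite /fourier.
under eq_bigr do rewrite fE mulr_suml.
rewrite exchange_big /= (bigD1 u) //= [X in _ + X]big1 => [|v vu].
  rewrite addr0; under eq_bigr do rewrite -mulrA character_conj //.
  rewrite -mulr_sumr sum_character // subrr eqxx mulr1 mulrCA mulVf ?qn_neq0 //.
  by rewrite mulr1.
under eq_bigr do rewrite -mulrA character_conj //.
by rewrite -mulr_sumr sum_character // subr_eq0 (negPf vu) !mulr0.
Qed.

(* Main.v *)
Require Import Defs.
From mathcomp Require Import all_boot all_order all_algebra.
From mathcomp Require Import complex.
From mathcomp Require Import reals.
From mathcomp Require Import zify ring.

Set Implicit Arguments.
Unset Strict Implicit.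
Unset Printing Implicit Defensive.

Import Order.TTheory GRing.Theory Num.Theory.
Local Open Scope ring_scope.

(** Along a relevant coordinate [r], restricting [f] to [x_r = b] and to
    [x_r = c] and subtracting lowers every Fourier weight by one. Two facts
    result. First, a nonzero function on [Z_q^n] with spectrum in the weights
    [i..j], [i + j <= n], has at least [2^i (q-1)^i q^(n-i-j)] nonzero values, by
    induction on [n]. Second, at least [2 (q-1)] ordered pairs [(b, c)] give
    different restrictions of [f], and by the first fact each such pair
    disagrees on many points, so the influence of every relevant coordinate is
    large. On the other hand Parseval bounds the sum of all influences of a
    [{-1,1}]-valued function of degree at most [d]. *)

(** * Restriction to hyperplanes and recombination of sums *)

Definition insert_coord (q n : nat) (r : 'I_n.+1) (b : 'Z_q)
    (y : 'rV['Z_q]_n) : 'rV['Z_q]_n.+1 :=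
  \row_j (if unlift r j is Some k then y 0 k else b).

Definition slice (q n : nat) (T : Type) (f : 'rV['Z_q]_n.+1 -> T)
    (r : 'I_n.+1) (b : 'Z_q) (y : 'rV['Z_q]_n) : T :=
  f (insert_coord r b y).

Definition fsupport (q n : nat) (V : nmodType) (f : 'rV['Z_q]_n -> V) :
    {set 'rV['Z_q]_n} :=
  [set x | f x != 0].

Definition spectrum_in (R : realType) (q n : nat) (i j : nat)
    (f : 'rV['Z_q]_n -> R[i]) : Prop :=
  forall u, ~~ (i <= hamming_weight u <= j)%N -> fourier f u = 0.

Lemma card_Zq (q : nat) : (1 < q)%N -> #|'Z_q| = q.
Proof. by move=> q1; rewrite card_ord Zp_cast. Qed.

Lemma insert_coord_eq (q n : nat) (r : 'I_n.+1) (b : 'Z_q) y :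
  insert_coord r b y 0 r = b.
Proof. by rewrite mxE unlift_none. Qed.

Lemma insert_coord_lift (q n : nat) (r : 'I_n.+1) (b : 'Z_q) y k :
  insert_coord r b y 0 (lift r k) = y 0 k.
Proof. by rewrite mxE liftK. Qed.

Lemma insert_coordP (q n : nat) (r : 'I_n.+1) (x : 'rV['Z_q]_n.+1) b
    (y : 'rV['Z_q]_n) :
  x 0 r = b -> (forall k, x 0 (lift r k) = y 0 k) -> x = insert_coord r b y.
Proof.
move=> xr xk; apply/rowP => j; case: (unliftP r j) => [k|] ->.
  by rewrite insert_coord_lift.
by rewrite insert_coord_eq.
Qed.

Lemma insert_coord_bij (q n : nat) (r : 'I_n.+1) :
  bijective (fun p : 'Z_q * 'rV['Z_q]_n => insert_coord r p.1 p.2).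
Proof.
exists (fun x : 'rV['Z_q]_n.+1 => (x 0 r, \row_k x 0 (lift r k))) => [[b y]|x] /=.
  rewrite insert_coord_eq; congr pair; apply/rowP => k.
  by rewrite mxE insert_coord_lift.
by symmetry; apply: insert_coordP => // k; rewrite mxE.
Qed.

Lemma big_insert_coord (S : Type) (idx : S) (op : Monoid.com_law idx)
    (q n : nat) (r : 'I_n.+1) (F : 'rV['Z_q]_n.+1 -> S) :
  \big[op/idx]_x F x =
  \big[op/idx]_(b : 'Z_q) \big[op/idx]_(y : 'rV['Z_q]_n) F (insert_coord r b y).
Proof.
rewrite pair_big /= (reindex (fun p : 'Z_q * 'rV['Z_q]_n =>
  insert_coord r p.1 p.2)) //=; exact/onW_bij/insert_coord_bij.
Qed.

Lemma card_insert_coord (q n : nat) (r : 'I_n.+1) (P : pred 'rV['Z_q]_n.+1) :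
  #|[set x | P x]| = (\sum_(b : 'Z_q) #|[set y | P (insert_coord r b y)]|)%N.
Proof.
have cardE m (Q : pred 'rV['Z_q]_m) : #|[set x | Q x]| = (\sum_x Q x)%N.
  by rewrite -sum1_card (eq_bigl Q) => [|x]; rewrite ?inE // big_mkcond;
    apply: eq_bigr => x _; case: (Q x).
by rewrite cardE (big_insert_coord _ r); apply: eq_bigr => b _; rewrite cardE.
Qed.

Lemma hamming_weight_insert (q n : nat) (r : 'I_n.+1) (b : 'Z_q)
    (v : 'rV['Z_q]_n) :
  hamming_weight (insert_coord r b v) = ((b != 0%R) + hamming_weight v)%N.
Proof.
have wE m (u : 'rV['Z_q]_m) : hamming_weight u = (\sum_k (u 0%R k != 0%R))%N.
  rewrite /hamming_weight -sum1_card (eq_bigl (fun k => u 0 k != 0)).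
    by rewrite big_mkcond; apply: eq_bigr => x _; case: (_ == _).
  by move=> x; rewrite inE.
rewrite !wE (@bigD1_ord _ _ _ n.+1 r) //= insert_coord_eq; congr addn.
by apply: eq_bigr => k _; rewrite insert_coord_lift.
Qed.

(** * Fourier coefficients and spectra of slices, differences and translates *)

Lemma character_insert (R : realType) (q n : nat) (r : 'I_n.+1) (a b : 'Z_q)
    (v y : 'rV['Z_q]_n) : (1 < q)%N ->
  character R (insert_coord r a v) (insert_coord r b y) =
  omega R q ^+ nat_of_ord (a * b) * character R v y.
Proof.
move=> q1; rewrite /character -omegaD //; congr (_ ^+ nat_of_ord _).
rewrite {1}/dot (@bigD1_ord _ _ _ n.+1 r) //= !insert_coord_eq; congr (_ + _).
by apply: eq_bigr => k _; rewrite !insert_coord_lift.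
Qed.

(** Grouping the expansion of [f] by the [r]-th coordinate [a] of the frequency gives an expansion
    of the slice; uniqueness of coefficients concludes. *)
Lemma fourier_slice (R : realType) (q n : nat) (f : 'rV['Z_q]_n.+1 -> R[i])
    (r : 'I_n.+1) (b : 'Z_q) (v : 'rV['Z_q]_n) : (1 < q)%N ->
  fourier (slice f r b) v =
  \sum_(a : 'Z_q) fourier f (insert_coord r a v) * omega R q ^+ nat_of_ord (a * b).
Proof.
move=> q1; symmetry; move: v; apply: fourier_unique => // y.
rewrite /slice (fourier_expansion f _ q1) (big_insert_coord _ r) exchange_big /=.
apply: eq_bigr => v _; rewrite mulr_suml; apply: eq_bigr => a _.
by rewrite character_insert // mulrA.
Qed.

Lemma fourierB (R : realType) (q n : nat) (f g : 'rV['Z_q]_n -> R[i]) u :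
  fourier (fun x => f x - g x) u = fourier f u - fourier g u.
Proof.
rewrite /fourier -mulrBr -sumrB; congr (_ * _).
by apply: eq_bigr => x _; rewrite mulrBl.
Qed.

Lemma fourier_shift (R : realType) (q n : nat) (f : 'rV['Z_q]_n -> R[i])
    (a u : 'rV['Z_q]_n) : (1 < q)%N ->
  fourier (fun x => f (x + a)) u = fourier f u * character R u a.
Proof.
move=> q1; symmetry; move: u; apply: fourier_unique => // x.
rewrite (fourier_expansion f _ q1); apply: eq_bigr => u _.
by rewrite !(characterC R u) characterDl // mulrA mulrAC.
Qed.

Lemma eq_fourier (R : realType) (q n : nat) (f g : 'rV['Z_q]_n -> R[i]) u :
  f =1 g -> fourier f u = fourier g u.
Proof. by move=> fg; congr (_ * _); apply: eq_bigr => x _; rewrite fg. Qed.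

Lemma fourier_neq0 (R : realType) (q n : nat) (f : 'rV['Z_q]_n -> R[i]) x :
  (1 < q)%N -> f x != 0 -> exists u, fourier f u != 0.
Proof.
move=> q1 fx; apply/existsP; apply: contraNT fx => /existsPn f0.
rewrite (fourier_expansion f _ q1) big1 // => u _.
by move: (f0 u); rewrite negbK => /eqP->; rewrite mul0r.
Qed.

Lemma spectrum_slice (R : realType) (q n i j : nat)
    (f : 'rV['Z_q]_n.+1 -> R[i]) (r : 'I_n.+1) (b : 'Z_q) : (1 < q)%N ->
  spectrum_in i j f -> spectrum_in i.-1 j (slice f r b).
Proof.
move=> q1 fs v wv; rewrite fourier_slice // big1 // => a _.
(* A frequency [v] of the slice collects frequencies of [f] of weight |v| or |v|+1, so only the
   lower end drops. *)
rewrite fs ?mul0r // hamming_weight_insert; case: (a != 0); lia.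
Qed.

(** The terms with [a = 0] do not depend on the slice and cancel, leaving only frequencies of weight
    |v|+1. The zero frequency cancels likewise, so the hypothesis leaves the mean of [f] free. *)
Lemma spectrum_sliceB (R : realType) (q n i j : nat)
    (f : 'rV['Z_q]_n.+1 -> R[i]) (r : 'I_n.+1) (b c : 'Z_q) y : (1 < q)%N ->
  (forall u, hamming_weight u != 0%N -> ~~ (i <= hamming_weight u <= j)%N ->
     fourier f u = 0) ->
  slice f r b y != slice f r c y ->
  (0 < j)%N /\ spectrum_in i.-1 j.-1 (fun y => slice f r b y - slice f r c y).
Proof.
move=> q1 fs fbc; set g := fun y => _ - _.
have g0 v : ~~ (i <= (hamming_weight v).+1 <= j)%N -> fourier g v = 0.
  move=> wv; rewrite fourierB !fourier_slice // -sumrB big1 // => a _.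
  have [->|a0] := eqVneq a 0; first by rewrite !mul0r subrr.
  by rewrite fs ?mul0r ?subrr // hamming_weight_insert a0.
have j0 : (0 < j)%N.
  have [u gu] : exists u, fourier g u != 0.
    by apply: (@fourier_neq0 _ _ _ g y q1); rewrite subr_eq0.
  by apply: contraNT gu => j0; rewrite g0 //; lia.
by split=> // v wv; apply: g0; lia.
Qed.

Lemma sum_omega (R : realType) (q : nat) (a : 'Z_q) : (1 < q)%N ->
  \sum_(b : 'Z_q) omega R q ^+ nat_of_ord (a * b) = q%:R * (a == 0)%:R.
Proof.
move=> q1; have := sum_character R (\row_(k < 1) a) q1.
rewrite expn1 => E; have -> : (a == 0) = ((\row_(k < 1) a) == 0 :> 'rV_1).
  apply/eqP/eqP => [->|/rowP/(_ 0)]; last by rewrite !mxE.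
  by apply/rowP => k; rewrite !mxE.
rewrite -E (reindex (fun x : 'rV['Z_q]_1 => x 0 0)) /=.
  by apply: eq_bigr => x _; rewrite /character /dot big_ord1 mxE.
exists (fun b => \row_(k < 1) b) => [x _|b _]; last by rewrite mxE.
by apply/rowP => k; rewrite mxE ord1.
Qed.

(** Such a slice is the sum of all slices, and summing over slices kills every frequency with
    nonzero [r]-th coordinate. What remains has weight exactly |v|, so the lower end does not
    drop. *)
Lemma spectrum_unique_slice (R : realType) (q n i j : nat)
    (f : 'rV['Z_q]_n.+1 -> R[i]) (r : 'I_n.+1) (b : 'Z_q) : (1 < q)%N ->
  spectrum_in i j f -> (forall c, c != b -> forall y, slice f r c y = 0) ->
  spectrum_in i j (slice f r b).
Proof.
move=> q1 fs f0 v wv.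
have E : fourier (slice f r b) v = \sum_c fourier (slice f r c) v.
  rewrite (bigD1 b) //= big1 ?addr0 // => c cb.
  by rewrite /fourier big1 ?mulr0 // => y _; rewrite f0 // mul0r.
rewrite E; under eq_bigr do rewrite fourier_slice //.
rewrite exchange_big /= big1 // => a _; rewrite -mulr_sumr sum_omega //.
have [->|a0] := eqVneq a 0; last by rewrite !mulr0.
by rewrite fs ?mul0r // hamming_weight_insert eqxx.
Qed.

Lemma dot_scale_delta (q n : nat) (u : 'rV['Z_q]_n) (r : 'I_n) (t : 'Z_q) :
  dot u (t *: delta_mx 0 r) = u 0 r * t.
Proof.
rewrite /dot (bigD1 r) //= !mxE !eqxx mulr1 big1 ?addr0 // => k kr.
by rewrite !mxE eqxx (negPf kr) !mulr0.
Qed.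

Lemma insert_coord_shift (q n : nat) (r : 'I_n.+1) (b t : 'Z_q)
    (y : 'rV['Z_q]_n) :
  insert_coord r b y + t *: delta_mx 0 r = insert_coord r (b + t) y.
Proof.
apply: insert_coordP => [|k]; rewrite !mxE ?unlift_none ?liftK !eqxx ?mulr1 //.
by rewrite eq_sym (negPf (neq_lift _ _)) mulr0 addr0.
Qed.

(** Choose [r] with [u 0 r] nonzero. Were [f] invariant under the unit shift along [r], its
    coefficient at [u] would equal itself times a power of [omega] different from 1. *)
Lemma relevant_slices (R : realType) (q n : nat)
    (f : 'rV['Z_q]_n.+1 -> R[i]) (u : 'rV['Z_q]_n.+1) : (1 < q)%N ->
  fourier f u != 0 -> (0 < hamming_weight u)%N ->
  exists r b c y, slice f r b y != slice f r c y.
Proof.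
move=> q1 fu /card_gt0P[r]; rewrite inE => ur; exists r.
have [x fx] : exists x, f (x + 1 *: delta_mx 0 r) != f x.
  apply/existsP; apply: contraNT fu => /existsPn fE.
  have /eqP := fourier_shift f (1 *: delta_mx 0 r) u q1.
  rewrite (eq_fourier (g := f)) => [|x]; last first.
    by apply/eqP; move: (fE x); rewrite negbK.
  rewrite -subr_eq0 -{1}[fourier f u]mulr1 -mulrBr mulf_eq0 subr_eq0.
  case/orP => //; rewrite eq_sym /character dot_scale_delta mulr1.
  rewrite (negPf (omegaX_neq1 _ _)) // lt0n; apply/andP; split; first exact: ur.
  by have := ltn_ord (u 0 r); rewrite [X in (_ < X)%N]Zp_cast.
have [g _ gK] := insert_coord_bij q r.
case: (g x) (gK x) => b y /= xE; rewrite -xE insert_coord_shift in fx.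
by exists (b + 1), b, y.
Qed.

(** * Lower bound on the size of the support *)

Lemma card_fsupport_slices (q n : nat) (V : nmodType)
    (f : 'rV['Z_q]_n.+1 -> V) (r : 'I_n.+1) :
  #|fsupport f| = (\sum_(b : 'Z_q) #|fsupport (slice f r b)|)%N.
Proof. exact: card_insert_coord. Qed.

Lemma card_fsupportB (q n : nat) (V : zmodType) (f g : 'rV['Z_q]_n -> V) :
  (#|fsupport (fun x => (f x - g x)%R)| <= #|fsupport f| + #|fsupport g|)%N.
Proof.
rewrite (leq_trans _ (leq_card_setU _ _)) // subset_leq_card //.
apply/subsetP => x; rewrite !inE; apply: contraNT; rewrite negb_or !negbK.
by case/andP => /eqP-> /eqP->; rewrite subrr.
Qed.

Lemma fsupport_gt0 (q n : nat) (V : nmodType) (f : 'rV['Z_q]_n -> V) x :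
  f x != 0 -> (0 < #|fsupport f|)%N.
Proof. by move=> fx; apply/card_gt0P; exists x; rewrite inE. Qed.

Lemma spectrum_in_neq0 (R : realType) (q n i j : nat)
    (f : 'rV['Z_q]_n -> R[i]) x : (1 < q)%N ->
  spectrum_in i j f -> f x != 0 ->
  exists2 u, fourier f u != 0 & (i <= hamming_weight u <= j)%N.
Proof.
move=> q1 fs /(fourier_neq0 q1)[u fu]; exists u => //.
by apply: contraNT fu => /fs->.
Qed.

(* Either all slices along a relevant coordinate are nonzero, or some slice
   vanishes and then the others coincide with differences of slices, whose
   spectrum is smaller. *)
Lemma min_support (R : realType) (q n i j : nat) (f : 'rV['Z_q]_n -> R[i]) x :
  (1 < q)%N -> (i + j <= n)%N -> spectrum_in i j f -> f x != 0 ->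
  (2 ^ i * q.-1 ^ i * q ^ (n - (i + j)) <= #|fsupport f|)%N.
Proof.
move=> q1; elim: n i j f x => [|n IHn] i j f x ijn fs fx.
  have [-> ->] : i = 0%N /\ j = 0%N by lia.
  by rewrite !expn0 (fsupport_gt0 fx).
have sliceB r b c y : slice f r c =1 (fun=> 0) -> slice f r b y != 0 ->
    (0 < j)%N /\ spectrum_in i.-1 j.-1 (slice f r b).
  move=> fc fb; have [||j0 gs] := @spectrum_sliceB _ _ _ i j f r b c y q1.
  - by move=> u _; apply: fs.
  - by rewrite fc.
  split=> // v /gs <-.
  by apply: eq_fourier => z; rewrite fc subr0.
(* For [i = 0] the target is q^(n+1-j), which is 1 when j = n+1; any coordinate serves for
   slicing. *)
case: i => [|i] in ijn fs sliceB *.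
  rewrite !expn0 !mul1n add0n.
  have [jn|jn] := ltnP n j.
    have -> : (n.+1 - j = 0)%N by lia.
    exact: fsupport_gt0 fx.
  (* Either all q slices are nonzero, each with at least q^(n-j) nonzero values, or one vanishes and
     a nonzero slice, of degree at most j-1, suffices alone. *)
  have [/forallP all0|/forallPn[c]] :=
      boolP [forall c, [exists y, slice f ord0 c y != 0]].
    rewrite (card_fsupport_slices f ord0) subSn // expnS -{1}(card_Zq q1).
    rewrite -sum_nat_const; apply: leq_sum => b _.
    have /existsP[y fy] := all0 b.
    have := IHn 0%N j _ y _ (spectrum_slice (i := 0) ord0 b q1 fs) fy.
    by rewrite !expn0 !mul1n add0n; apply.
  rewrite negb_exists => /forallP fc.
  have {}fc : slice f ord0 c =1 (fun=> 0).
    by move=> y; apply/eqP; move: (fc y); rewrite negbK.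
  have [g _ gK] := insert_coord_bij q (ord0 : 'I_n.+1).
  case: (g x) (gK x) => b y /= xE; rewrite -xE in fx.
  have [j0 bs] := sliceB ord0 b c y fc fx.
  rewrite (card_fsupport_slices f ord0) (bigD1 b) //=.
  rewrite (leq_trans _ (leq_addr _ _)) //.
  have := IHn 0%N j.-1 _ y _ bs fx.
  rewrite !expn0 !mul1n add0n; have -> : (n - j.-1 = n.+1 - j)%N by lia.
  by apply; lia.
have [u fu wu] := spectrum_in_neq0 q1 fs fx.
have [r [b [c [y fbc]]]] : exists r b c y, slice f r b y != slice f r c y.
  by apply: (relevant_slices q1 fu); lia.
have [||j0 gs] := @spectrum_sliceB _ _ _ i.+1 j f r b c y q1 => //.
  by move=> v _; apply: fs.
(* [A] is the inductive bound for a slice, with weights in [i]..[j]; losing the top weight as well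
   improves it to [q * A]. The target is 2(q-1)A. *)
set A := (2 ^ i * q.-1 ^ i * q ^ (n - (i + j)))%N.
have lowD (g : 'rV['Z_q]_n -> R[i]) z :
    spectrum_in i j.-1 g -> g z != 0 -> (q * A <= #|fsupport g|)%N.
  move=> gs' gz; have := IHn i j.-1 g z _ gs' gz.
  have -> : (n - (i + j.-1) = (n - (i + j)).+1)%N by lia.
  by rewrite expnS mulnCA; apply; lia.
have lowS a z : slice f r a z != 0 -> (A <= #|fsupport (slice f r a)|)%N.
  by move=> fz; apply: IHn (spectrum_slice r a q1 fs) fz; lia.
have -> : (2 ^ i.+1 * q.-1 ^ i.+1 * q ^ (n.+1 - (i.+1 + j)) = 2 * q.-1 * A)%N.
  by rewrite /A !expnS addSn subSS mulnACA !mulnA.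
have bc : b != c by apply: contraNneq fbc => ->.
rewrite (card_fsupport_slices f r).
have [/forallP all0|/forallPn[a]] :=
    boolP [forall a, [exists y, slice f r a y != 0]].
  (* Here 2(q-1) = q + (q-2): the supports of slices [b] and [c] cover that of their difference,
     worth [q * A], and each other slice contributes [A]. *)
  rewrite (bigD1 b) //= (bigD1 c) 1?eq_sym //= addnA.
  have hbc : (q * A <= #|fsupport (slice f r b)| + #|fsupport (slice f r c)|)%N.
    by apply: leq_trans (card_fsupportB _ _); apply: (lowD _ y gs); rewrite subr_eq0.
  have hrest : (q.-2 * A <=
      \sum_(a | (a != b) && (a != c)) #|fsupport (slice f r a)|)%N.
    have -> : q.-2 = #|[pred a : 'Z_q | (a != b) && (a != c)]|.
      rewrite -[in LHS](card_Zq q1) -(cardC (pred2 b c)) card2 bc.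
      by apply: eq_card => a; rewrite !inE negb_or.
    rewrite -sum_nat_const; apply: leq_sum => a _.
    by have /existsP[z /lowS] := all0 a.
  by apply: leq_trans (leq_add hbc hrest); rewrite -mulnDl leq_mul2r; lia.
rewrite negb_exists => /forallP fa.
have {}fa : slice f r a =1 (fun=> 0).
  by move=> z; apply/eqP; move: (fa z); rewrite negbK.
(* Next to a zero slice, every nonzero slice is itself a difference of slices; two of them give
   2qA. *)
have lowN e z : slice f r e z != 0 -> (q * A <= #|fsupport (slice f r e)|)%N.
  by move=> fe; have [_ es] := sliceB r e a z fa fe; apply: lowD es fe.
have [g _ gK] := insert_coord_bij q r.
case: (g x) (gK x) => e z /= xE; rewrite -xE in fx.
rewrite (bigD1 e) //=.
have [/existsP[e' /andP[ee' /existsP[z' fz']]]|] :=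
    boolP [exists e', (e' != e) && [exists z, slice f r e' z != 0]].
  rewrite (bigD1 e') //= addnA (leq_trans _ (leq_addr _ _)) //.
  apply: leq_trans (leq_add (lowN _ _ fx) (lowN _ _ fz')).
  by rewrite addnn -mul2n mulnA leq_mul2r leq_mul2l leq_pred !orbT.
rewrite negb_exists => /forallP one.
(* A lone nonzero slice keeps the lower end, being the sum of all slices, and loses the top weight,
   being a difference. Induction then yields the whole target from it. *)
have es : spectrum_in i.+1 j.-1 (slice f r e).
  have [_ es] := sliceB r e a z fa fx.
  have es' : spectrum_in i.+1 j (slice f r e).
    apply: spectrum_unique_slice => // e' ee' w; apply/eqP.
    by move: (one e'); rewrite ee' negb_exists => /forallP/(_ w); rewrite negbK.
  move=> v wv; have [wv'|] := boolP (i.+1 <= hamming_weight v <= j)%N; last exact: es'.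
  by apply: es; lia.
rewrite (leq_trans _ (leq_addr _ _)) //; have := IHn i.+1 j.-1 _ z _ es fx.
have -> : (n - (i.+1 + j.-1) = n - (i + j))%N by lia.
by rewrite !expnS mulnACA -!mulnA -/A => ->//; lia.
Qed.

(** * Parseval and the total influence *)

Lemma parseval (R : realType) (q n : nat) (g : 'rV['Z_q]_n -> R[i]) :
  (1 < q)%N ->
  \sum_x `|g x| ^+ 2 = (q ^ n)%:R * \sum_u `|fourier g u| ^+ 2.
Proof.
move=> q1; rewrite mulr_sumr; transitivity (\sum_x \sum_u
    (fourier g u)^* * (g x * (character R u x)^*)).
  apply: eq_bigr => x _; rewrite normCK {2}(fourier_expansion g x q1) rmorph_sum.
  rewrite mulr_sumr; apply: eq_bigr => u _.
  by rewrite rmorphM mulrCA.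
rewrite exchange_big; apply: eq_bigr => u _ /=; rewrite -mulr_sumr normCK.
have -> : \sum_x g x * (character R u x)^* = (q ^ n)%:R * fourier g u.
  by rewrite mulVKf // qn_neq0.
by rewrite mulrCA (mulrC (fourier g u)).
Qed.

(** For z on the unit circle, |z-1|^2 is 2 minus z minus its conjugate, and the powers of [omega]
    sum to zero unless [a = 0]. *)
Lemma sum_norm_omega_sub1 (R : realType) (q : nat) (a : 'Z_q) : (1 < q)%N ->
  \sum_(t : 'Z_q) `|omega R q ^+ nat_of_ord (a * t) - 1| ^+ 2 =
  (2 * q)%:R * (a != 0)%:R.
Proof.
move=> q1; set z := fun t => omega R q ^+ nat_of_ord (a * t).
have zz t : z t * (z t)^* = 1 by rewrite rmorphXn -exprMn omega_conj expr1n.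
have E t : `|z t - 1| ^+ 2 = 2 - z t - (z t)^*.
  by rewrite normCK rmorphB rmorph1 mulrBl !mulrBr zz; ring.
under eq_bigr do rewrite E.
have Sz : \sum_t z t = q%:R * (a == 0)%:R by apply: sum_omega.
have Szc : \sum_t (z t)^* = q%:R * (a == 0)%:R.
  by rewrite -rmorph_sum Sz rmorphM !rmorph_nat.
rewrite !sumrB Sz Szc sumr_const card_Zq //.
by case: (a == 0) => /=; rewrite natrM; ring.
Qed.

Lemma sum_norm_shiftB (R : realType) (q n : nat) (g : 'rV['Z_q]_n -> R[i])
    (r : 'I_n) : (1 < q)%N ->
  \sum_(t : 'Z_q) \sum_x `|g (x + t *: delta_mx 0 r) - g x| ^+ 2 =
  (2 * q ^ n.+1)%:R * \sum_(u : 'rV['Z_q]_n) (u 0 r != 0)%:R * `|fourier g u| ^+ 2.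
Proof.
move=> q1; have E t : \sum_x `|g (x + t *: delta_mx 0 r) - g x| ^+ 2 =
    (q ^ n)%:R * \sum_u
      `|fourier g u| ^+ 2 * `|omega R q ^+ nat_of_ord (u 0 r * t) - 1| ^+ 2.
  rewrite (parseval (fun x => _ - g x)) //; congr (_ * _); apply: eq_bigr => u _.
  rewrite fourierB fourier_shift // /character dot_scale_delta.
  by rewrite -exprMn -normrM mulrBr mulr1.
rewrite (eq_bigr _ (fun t _ => E t)) -mulr_sumr exchange_big /= !mulr_sumr.
apply: eq_bigr => u _; rewrite -mulr_sumr sum_norm_omega_sub1 //.
by rewrite expnS !natrM; ring.
Qed.

(** Unnormalised: this counts ordered pairs of points on a common line in direction [r] with
    different values. The shift [t = 0] contributes nothing. *)
Definition influence (q n : nat) (T : eqType) (f : 'rV['Z_q]_n -> T)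
    (r : 'I_n) : nat :=
  (\sum_(t : 'Z_q) #|[set x | f (x + t *: delta_mx 0 r)%R != f x]|)%N.

(** The squared difference of two signs is 4 or 0, so [sum_norm_shiftB] computes four times the
    influence; a factor 2 is then cancelled. *)
Lemma influence_sign (R : realType) (q n : nat) (g : 'rV['Z_q]_n -> R[i])
    (r : 'I_n) : (1 < q)%N -> (forall x, g x = -1 \/ g x = 1) ->
  (2 * influence g r)%:R =
  (q ^ n.+1)%:R * \sum_(u : 'rV['Z_q]_n) (u 0 r != 0)%:R * `|fourier g u| ^+ 2.
Proof.
move=> q1 gs; have S := sum_norm_shiftB g r q1.
rewrite natrM -mulrA in S; apply: (mulfI (_ : 2 != 0)); first by rewrite pnatr_eq0.
have n4 : `|1 - -1| ^+ 2 = 4 :> R[i] by rewrite opprK -[1 + 1]/(2%:R) normr_nat; ring.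
have n10 : (1 == -1 :> R[i]) = false.
  by rewrite -subr_eq0 opprK -[1 + 1]/(2%:R) pnatr_eq0.
rewrite -S -natrM mulnA /influence big_distrr natr_sum.
apply: eq_bigr => t _; rewrite -sum1dep_card natrM natr_sum.
rewrite big_mkcond mulr_sumr; apply: eq_bigr => x _.
case: (gs x) => ->; case: (gs (x + t *: delta_mx 0 r)) => ->;
  by rewrite ?eqxx ?[-1 == 1]eq_sym ?n10 ?subrr ?normr0 ?expr0n ?mulr0 //=
             ?[`|-1 - 1|]distrC n4 mulr1.
Qed.

(** Summed over [r], each squared coefficient is counted once per nonzero coordinate of [u], at most
    [d] times, and the squared coefficients sum to 1. *)
Lemma total_influence_le (R : realType) (q n d : nat)
    (g : 'rV['Z_q]_n -> R[i]) : (1 < q)%N ->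
  (forall x, g x = -1 \/ g x = 1) -> spectrum_in 0 d g ->
  (2 * \sum_r influence g r <= d * q ^ n.+1)%N.
Proof.
move=> q1 gs gd; rewrite -(ler_nat R[i]) big_distrr natr_sum /=.
rewrite (eq_bigr _ (fun r _ => influence_sign r q1 gs)) -mulr_sumr.
rewrite exchange_big /= natrM mulrC ler_wpM2r ?ler0n //.
have sum1 : \sum_u `|fourier g u| ^+ 2 = 1.
  apply: (mulfI (qn_neq0 R n q1)); rewrite -parseval // mulr1.
  rewrite (eq_bigr (fun=> 1)) => [|x _].
    by rewrite sumr_const card_mx card_Zq // mul1n.
  by case: (gs x) => ->; rewrite ?normrN normr1 expr1n.
rewrite -[d%:R]mulr1 -[X in _ <= _ * X]sum1 mulr_sumr; apply: ler_sum => u _.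
rewrite -mulr_suml.
have -> : \sum_r (u 0 r != 0)%:R = (hamming_weight u)%:R :> R[i].
  rewrite /hamming_weight -sum1dep_card natr_sum [RHS]big_mkcond.
  by apply: eq_bigr => r _; case: (_ != _).
have [wu|wu] := leqP (hamming_weight u) d.
  by rewrite ler_wpM2r ?exprn_ge0 ?ler_nat.
by rewrite gd ?normr0 ?expr0n ?mulr0 //= -ltnNge.
Qed.

(** * Lower bound on the influence of a relevant coordinate *)

Lemma influence_slices (q n : nat) (T : eqType) (f : 'rV['Z_q]_n.+1 -> T)
    (r : 'I_n.+1) :
  influence f r =
  (\sum_a \sum_b #|[set y | slice f r a y != slice f r b y]|)%N.
Proof.
rewrite exchange_big /=; transitivity (\sum_(t : 'Z_q) \sum_(b : 'Z_q)
    #|[set y | slice f r (b + t)%R y != slice f r b y]|)%N.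
  apply: eq_bigr => t _; rewrite (card_insert_coord r); apply: eq_bigr => b _.
  by apply: eq_card => y; rewrite !inE insert_coord_shift.
rewrite exchange_big; apply: eq_bigr => b _ /=.
by rewrite [RHS](reindex_inj (addrI b)).
Qed.

(** Rows [p] and [s] together give |T| times [M]; by symmetry each of the other |T|-2 rows gives [M]
    from its entries in columns [p] and [s]. *)
Lemma sum_pairs_ge (T : finType) (g : T -> T -> nat) (M : nat) (p s : T) :
  p != s -> (forall a b, g a b = g b a) ->
  (forall a, M <= g p a + g s a)%N ->
  (2 * #|T|.-1 * M <= \sum_a \sum_b g a b)%N.
Proof.
move=> ps gC gM; rewrite (bigD1 p) //= [X in (_ + X)%N](bigD1 s) 1?eq_sym //=.
rewrite addnA -big_split /=.
have h1 : (#|T| * M <= \sum_a (g p a + g s a))%N.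
  by rewrite -sum_nat_const; apply: leq_sum.
have h2 : (#|T|.-2 * M <= \sum_(a | (a != p) && (a != s)) \sum_b g a b)%N.
  have -> : #|T|.-2 = #|[pred a | (a != p) && (a != s)]|.
    rewrite -(cardC (pred2 p s)) card2 ps.
    by apply: eq_card => a; rewrite !inE negb_or.
  rewrite -sum_nat_const; apply: leq_sum => a _.
  rewrite (bigD1 p) //= (bigD1 s) 1?eq_sym //= addnA (leq_trans _ (leq_addr _ _)) //.
  by rewrite !(gC a).
apply: leq_trans (leq_add h1 h2); rewrite -mulnDl leq_mul2r; apply/orP; right.
have := max_card (pred2 p s); rewrite card2 ps; move: #|_| => t; lia.
Qed.

Lemma influence_ge (R : realType) (q n i j : nat)
    (f : 'rV['Z_q]_n.+1 -> R[i]) (r : 'I_n.+1) : (1 < q)%N ->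
  (0 < i)%N -> (i + j <= n.+2)%N ->
  (forall u, hamming_weight u != 0%N -> ~~ (i <= hamming_weight u <= j)%N ->
     fourier f u = 0) ->
  relevant f r ->
  (2 ^ i * q.-1 ^ i * q ^ (n.+2 - (i + j)) <= influence f r)%N.
Proof.
move=> q1 i0 ijn fs /existsP[x /existsP[p /existsP[s]]].
set y := (\row_k x 0 (lift r k)).
have E b : set_coord x r b = insert_coord r b y.
  apply: insert_coordP => [|k]; rewrite !mxE ?eqxx //.
  by rewrite eq_sym (negPf (neq_lift _ _)).
rewrite !E -![f _]/(slice f r _ y) => fps.
have ps : p != s by apply: contraNneq fps => ->.
set M := (2 ^ i.-1 * q.-1 ^ i.-1 * q ^ (n.+2 - (i + j)))%N.
(* Two distinct slices disagree on the support of their difference, to which [min_support] applies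
   with both ends lowered by one. *)
have low a b z : slice f r a z != slice f r b z ->
    (M <= #|[set y | slice f r a y != slice f r b y]|)%N.
  move=> fab; have [j0 gs] := spectrum_sliceB q1 fs fab.
  have := min_support (x := z) q1 _ gs.
  have -> : (n - (i.-1 + j.-1) = n.+2 - (i + j))%N by lia.
  rewrite subr_eq0 -/M (@eq_card _ _ [set y | slice f r a y != slice f r b y]).
    by apply=> //; lia.
  by move=> w; rewrite !inE subr_eq0.
have -> : (2 ^ i * q.-1 ^ i * q ^ (n.+2 - (i + j)) = 2 * #|'Z_q|.-1 * M)%N.
  by rewrite card_Zq // -{1 2}(prednK i0) !expnS /M mulnACA !mulnA.
rewrite influence_slices; apply: (sum_pairs_ge (p := p) (s := s)) => //.
  by move=> a b; apply: eq_card => w; rewrite !inE eq_sym.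
(* Slices [p] and [s] differ at [y], so slice [a] differs there from at least one of them. *)
move=> a; have [pa|/low h] := eqVneq (slice f r p y) (slice f r a y).
  by rewrite (leq_trans _ (leq_addl _ _)) // (low _ _ y) // -pa eq_sym.
by rewrite (leq_trans h) ?leq_addr.
Qed.

(** * Reduction to sign values and the final count *)

Lemma fourier1 (R : realType) (q n : nat) (u : 'rV['Z_q]_n) : (1 < q)%N ->
  fourier (fun=> 1 : R[i]) u = (u == 0)%:R.
Proof.
move=> q1; rewrite /fourier; under eq_bigr do rewrite mul1r.
rewrite -rmorph_sum sum_character // rmorphM !rmorph_nat mulKf //.
exact: qn_neq0.
Qed.

Lemma hamming_weight0 (q n : nat) : hamming_weight (0 : 'rV['Z_q]_n) = 0%N.
Proof. by apply: eq_card0 => k; rewrite !inE mxE eqxx. Qed.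

Lemma sign_of_boolean (R : realType) (q n d : nat)
    (f : 'rV['Z_q]_n -> R[i]) : (1 < q)%N ->
  ((forall x, f x = 0 \/ f x = 1) \/ (forall x, f x = -1 \/ f x = 1)) ->
  spectrum_in 0 d f ->
  exists g : 'rV['Z_q]_n -> R[i],
    [/\ forall x, g x = -1 \/ g x = 1, spectrum_in 0 d g &
        forall x y, (g x == g y) = (f x == f y)].
Proof.
move=> q1 [f01|fs] fd; last by exists f.
(* This is 2f - 1, written as differences so that [fourierB] applies; only the coefficient at 0 is
   affected by the constant. *)
exists (fun x => f x - (1 - f x)); split=> [x|u wu|x y].
- by case: (f01 x) => ->; [left|right]; ring.
- rewrite !fourierB fourier1 // fd //.
  have [u0|_] := eqVneq u 0; last by rewrite !subr0.
  by rewrite u0 hamming_weight0 in wu.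
- rewrite -subr_eq0 -[RHS]subr_eq0.
  have -> : f x - (1 - f x) - (f y - (1 - f y)) = 2 * (f x - f y) by ring.
  by rewrite mulf_eq0 pnatr_eq0.
Qed.

Theorem theorem2 (R : realType) (q n d' d : nat)
    (hq : (3 <= q)%N) (hn : (1 <= n)%N)
    (hd' : (1 <= d')%N) (hd'd : (d' <= d)%N) (hdn : (d <= n)%N)
    (hdd' : (d' + d <= n + 1)%N)
    (f : 'rV['Z_q]_n -> R[i])
    (hf : (forall x, f x = 0 \/ f x = 1) \/ (forall x, f x = -1 \/ f x = 1))
    (hfhat : forall u : 'rV['Z_q]_n,
      ~ (hamming_weight u = 0%N \/ (d' <= hamming_weight u <= d)%N) ->
      fourier f u = 0) :
  (#|[set i : 'I_n | relevant f i]|%:R : R) <=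
    d%:R / 2%:R * (q%:R ^+ (d + d') / (2%:R ^+ d' * (q%:R - 1) ^+ d')).
Proof.
have q1 : (1 < q)%N by apply: ltnW.
case: n hn hdn hdd' f hf hfhat => // n _ hdn hdd' f hf hfhat.
have fs u : hamming_weight u != 0%N -> ~~ (d' <= hamming_weight u <= d)%N ->
    fourier f u = 0.
  by move=> /eqP w0 /negP w; apply: hfhat => -[].
have [g [gs gd gE]] : exists g : 'rV['Z_q]_n.+1 -> R[i],
    [/\ forall x, g x = -1 \/ g x = 1, spectrum_in 0 d g &
        forall x y, (g x == g y) = (f x == f y)].
  by apply: sign_of_boolean => // u wu; apply: fs; lia.
have infE r : influence f r = influence g r.
  by apply: eq_bigr => t _; apply: eq_card => x; rewrite !inE gE.
set B := (2 ^ d' * q.-1 ^ d')%N; set N := #|_|.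
(* The claim with denominators cleared. With [n.+1] variables, multiplying by q^(n+2-(d'+d)) turns
   the left side into twice the sum of the influence lower bounds over relevant coordinates, and the
   right side into the total influence bound. *)
have main : (N * B * 2 <= d * q ^ (d + d'))%N.
  have q0 : (0 < q ^ (n.+2 - (d' + d)))%N by rewrite expn_gt0 ltnW.
  rewrite -(leq_pmul2r q0) -[leqRHS]mulnA -expnD.
  have -> : (d + d' + (n.+2 - (d' + d)) = n.+2)%N by lia.
  apply: leq_trans (total_influence_le q1 gs gd).
  rewrite mulnAC [leqLHS]mulnC -(mulnA N).
  rewrite leq_mul2l /= [leqRHS](bigID (relevant f)) /=.
  rewrite (leq_trans _ (leq_addr _ _)) // /N -sum1dep_card big_distrl /=.
  apply: leq_sum => r fr; rewrite mul1n -infE; apply: influence_ge => //; lia.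
have qE : q%:R - 1 = q.-1%:R :> R by rewrite -subn1 natrB // ltnW.
have B0 : 0 < B%:R :> R by rewrite ltr0n muln_gt0 !expn_gt0; lia.
have -> : 2%:R ^+ d' * (q%:R - 1) ^+ d' = B%:R :> R by rewrite qE natrM !natrX.
rewrite mulrA ler_pdivlMr // mulrAC ler_pdivlMr ?ltr0n //.
by rewrite -natrX -!natrM ler_nat.
Qed.
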